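(* Let $c>1$. Then for all sufficiently large $d>0$, $$\chi(\mathbb{H},[d,cd])<2\left(2e^{\frac{cd-1}{2}}+1\right)(cd+1).$$
   Context: $\mathbb{H}=\{(x,y)\in\mathbb{R}^2 : y>0\}$ is the hyperbolic plane (upper half-plane model) with distance $d_{\mathbb{H}}((x,y),(x',y'))=\operatorname{arccosh}\left(1+\frac{(x-x')^2+(y-y')^2}{2yy'}\right)$. For $0<d$ and $c>1$, $\chi(\mathbb{H},[d,cd])$ denotes the minimal number of colors needed to color all points of $\mathbb{H}$ so that any two points whose hyperbolic distance lies in the interval $[d,cd]$ receive different colors. *)

(* Defs.v *)
From HB Require Import structures.
From mathcomp Require Import all_boot all_order all_algebra.
From mathcomp Require Import all_classical all_reals all_analysis.
From mathcomp Require Import ring lra.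

Set Implicit Arguments.
Unset Strict Implicit.
Unset Printing Implicit Defensive.

Import Order.TTheory GRing.Theory Num.Theory.

Local Open Scope ring_scope.

Definition arccosh (R : realType) (x : R) : R :=
  ln (x + Num.sqrt (x ^+ 2 - 1)).

(* [arccosh] is the nonnegative inverse of cosh t = (e^t + e^-t) / 2. *)
Lemma arccosh_ge0 (R : realType) (x : R) : 1 <= x -> 0 <= arccosh x.
Proof.
move=> x1; apply: ln_ge0; have := sqrtr_ge0 (x ^+ 2 - 1); lra.
Qed.

Lemma cosh_arccosh (R : realType) (x : R) : 1 <= x ->
  (expR (arccosh x) + expR (- arccosh x)) / 2 = x.
Proof.
move=> x1; rewrite expRN /arccosh.
have s0 := sqrtr_ge0 (x ^+ 2 - 1).
have s2 : Num.sqrt (x ^+ 2 - 1) ^+ 2 = x ^+ 2 - 1.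
  by rewrite sqr_sqrtr // subr_ge0 expr_ge1 //; lra.
have p0 : 0 < x + Num.sqrt (x ^+ 2 - 1) by lra.
rewrite lnK ?posrE //.
have -> : (x + Num.sqrt (x ^+ 2 - 1))^-1 = x - Num.sqrt (x ^+ 2 - 1).
  apply: (mulfI (lt0r_neq0 p0)); rewrite divff ?lt0r_neq0 //.
  by rewrite mulrC -subr_sqr s2; ring.
by field.
Qed.

Definition hplane (R : realType) : Type := {p : R * R | 0 < p.2}.

Definition hdist (R : realType) (p q : hplane R) : R :=
  let: (x, y) := val p in
  let: (x', y') := val q in
  arccosh (1 + ((x - x') ^+ 2 + (y - y') ^+ 2) / (2 * y * y')).

Definition hcolorable (R : realType) (a b : R) (n : nat) : Prop :=
  exists f : hplane R -> 'I_n,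
    forall p q : hplane R, a <= hdist p q <= b -> f p <> f q.

(* chi(H, [a, b]): the least number of colors of a proper coloring, with the
   value +oo when no finite number of colors suffices. *)
Definition hchi (R : realType) (a b : R) : \bar R :=
  match pselect (exists n, `[< hcolorable a b n >]) with
  | left ex => (ex_minn ex)%:R%:E
  | right _ => +oo%E
  end.

(* Main.v *)
(** Cut the upper half-plane into horizontal strips [e^k <= y < e^(k+1)], and the
    [k]-th strip into boxes of Euclidean width [4 e e^k].  These boxes are
    isometric images of one another, hence have a common bounded diameter, which
    is less than [d] once [d] is large.  Colour the box [(k, j)] by
    [(k mod K, j mod m)].  The distance is at least [|ln y - ln y'|], so [K] about
    [cd + 2] separates the strips of the same colour; within a strip, a horizontal
    gap of [e^(cd/2) e^(k+1)] forces a distance larger than [cd], so [m] about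
    [e^(cd/2) / 4 + 2] suffices.  The bound follows since the [K * m] colours
    number fewer than [2 (e^(cd/2) + 1) (cd + 1)] and [e^(-1/2) >= 1/2]. *)

Require Import Defs.
From HB Require Import structures.
From mathcomp Require Import all_boot all_order all_algebra.
From mathcomp Require Import all_classical all_reals all_analysis.
From mathcomp Require Import ring lra zify.

Set Implicit Arguments.
Unset Strict Implicit.
Unset Printing Implicit Defensive.

Import Order.TTheory GRing.Theory Num.Theory.

Local Open Scope ring_scope.

Definition residue (n : nat) (a : int) : 'I_n.+1 := inord `|(a %% n.+1%:Z)%Z|%N.

Lemma residue_eq (n : nat) (a b : int) : residue n a = residue n b ->
  [\/ a = b, a + n.+1%:Z <= b | b + n.+1%:Z <= a].
Proof.
have ltmod (z : int) : (`|(z %% n.+1%:Z)%Z| < n.+1)%N.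
  by have := ltz_pmod z (isT : 0 < n.+1%:Z); have := modz_ge0 z (isT : n.+1%:Z != 0); lia.
move=> /(congr1 val); rewrite /= !inordK // => e.
have /eqP : (a %% n.+1%:Z)%Z = (b %% n.+1%:Z)%Z.
  have := modz_ge0 a (isT : n.+1%:Z != 0).
  by have := modz_ge0 b (isT : n.+1%:Z != 0); lia.
rewrite eqz_mod_dvd => /dvdzP [q ab].
have [q0|q0|q0] := ltgtP q 0.
- by apply: Or32; nia.
- by apply: Or33; nia.
- by apply: Or31; move: ab; rewrite q0 mul0r; lia.
Qed.

Section HyperbolicPlane.
Variable R : realType.
Implicit Types (x y t A : R) (p q : hplane R).

(** Distinct congruent floors differ by at least [n.+1], and passing to floors changes a difference
    by less than 1. *)
Lemma residue_floor_eq (n : nat) x y :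
  residue n (Num.floor x) = residue n (Num.floor y) ->
  Num.floor x = Num.floor y \/ n%:R < `|x - y|.
Proof.
have /andP [x1 x2] := floor_itv x; have /andP [y1 y2] := floor_itv y.
move: x2 y2; rewrite !intrD => x2 y2.
case/residue_eq => [->|h|h]; [by left|right|right]; move: h;
  rewrite -(ler_int R) intrD -[(n.+1 : int)%:~R]/(n.+1%:R) -natr1 => h.
- by rewrite distrC ltr_normr; apply/orP; left; lra.
- by rewrite ltr_normr; apply/orP; left; lra.
Qed.

(** The hypothesis reads cosh (ln t) <= A; then sinh (ln t) <= sqrt (A^2 - 1), and cosh + sinh =
    exp. *)
Lemma ln_le_arccosh A t : 1 <= t -> (t + t^-1) / 2 <= A -> ln t <= arccosh A.
Proof.
move=> t1 tA; have t0 : 0 < t by lra.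
have tV : t * t^-1 = 1 by rewrite divff ?gt_eqF.
have tV0 : 0 < t^-1 by rewrite invr_gt0.
have tV1 : t^-1 <= 1 by rewrite invf_le1.
have sA : (t - t^-1) / 2 <= Num.sqrt (A ^+ 2 - 1).
  have h0 : 0 <= (t - t^-1) / 2 by lra.
  rewrite -(ger0_norm h0) -sqrtr_sqr ler_wsqrtr //.
  have -> : ((t - t^-1) / 2) ^+ 2 = ((t + t^-1) / 2) ^+ 2 - t * t^-1 by field; lra.
  by rewrite tV lerD2r lerXn2r ?nnegrE //; lra.
by rewrite /arccosh ler_ln ?posrE //; lra.
Qed.

Lemma arccosh_le_ln A : 1 <= A -> arccosh A <= ln (2 * A).
Proof.
move=> A1; have s0 := sqrtr_ge0 (A ^+ 2 - 1).
have sA : Num.sqrt (A ^+ 2 - 1) <= A.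
  have A0 : 0 <= A by lra.
  by rewrite -[leRHS](ger0_norm A0) -sqrtr_sqr ler_wsqrtr // gerBl.
by rewrite /arccosh ler_ln ?posrE; lra.
Qed.

Lemma hdistE p q : hdist p q =
  arccosh (1 + (((val p).1 - (val q).1) ^+ 2 + ((val p).2 - (val q).2) ^+ 2)
                / (2 * (val p).2 * (val q).2)).
Proof. by rewrite /hdist; case: p q => -[x y] ? [[x' y'] ?]. Qed.

(** The argument of [arccosh] exceeds cosh (ln y - ln y') by exactly (x - x')^2 / (2 y y'). *)
Lemma dist_ln_le_hdist p q : `|ln (val p).2 - ln (val q).2| <= hdist p q.
Proof.
rewrite hdistE; case: p q => -[x y] /= y0 [[x' y'] /= y'0].
rewrite -[leLHS]expRK; apply: ln_le_arccosh; first by rewrite -expR0 ler_expR.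
rewrite -expRN.
have -> : expR `|ln y - ln y'| + expR (- `|ln y - ln y'|) = y / y' + y' / y.
  have e1 : expR (ln y - ln y') = y / y' by rewrite expRD expRN !lnK ?posrE.
  have e2 : expR (- (ln y - ln y')) = y' / y.
    by rewrite opprB expRD expRN !lnK ?posrE.
  have [_|_] := ger0P (ln y - ln y'); first by rewrite e1 e2.
  by rewrite opprK e1 e2 addrC.
rewrite -subr_ge0.
have -> : 1 + ((x - x') ^+ 2 + (y - y') ^+ 2) / (2 * y * y')
            - (y / y' + y' / y) / 2 = (x - x') ^+ 2 / (2 * y * y').
  by field; lra.
by rewrite divr_ge0 ?sqr_ge0 // !mulr_ge0 // ltW.
Qed.

Lemma hdist_gt_horizontal p q (s t : R) :
  (val p).2 <= s -> (val q).2 <= s ->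
  s * expR (t / 2) <= `|(val p).1 - (val q).1| -> t < hdist p q.
Proof.
rewrite hdistE; case: p q => -[x y] /= y0 [[x' y'] /= y'0] ys y's sx.
set A := 1 + _.
have t0 := expR_gt0 t.
have tE : expR t = expR (t / 2) ^+ 2 by rewrite expr2 -expRD; congr expR; lra.
have yy : 0 < 2 * y * y' by rewrite !mulr_gt0.
have yys : y * y' <= s ^+ 2 by rewrite expr2 ler_pM // ltW.
have s2x : s ^+ 2 * expR t <= (x - x') ^+ 2.
  rewrite tE -exprMn -(real_normK (num_real (x - x'))) lerXn2r ?nnegrE //.
  by rewrite mulr_ge0 ?expR_ge0 //; lra.
have tA : 1 + expR t / 2 <= A.
  rewrite lerD2l ler_pdivlMr //; have := sqr_ge0 (y - y').
  have : y * y' * expR t <= s ^+ 2 * expR t by rewrite ler_pM2r.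
  lra.
(* Strictness comes from using e^t + 1 in place of e^t: cosh (ln (e^t + 1)) is still at most 1 + e^t
   / 2. *)
have ltt : t < ln (expR t + 1).
  by rewrite -[ltLHS]expRK ltr_ln ?posrE //; lra.
apply: (lt_le_trans ltt); apply: ln_le_arccosh; first by lra.
suff : (expR t + 1)^-1 <= 1 by lra.
by rewrite invf_le1; lra.
Qed.

(** The scale [s] cancels, since y y' >= s^2; hence one diameter bound serves the boxes of every
    strip. *)
Lemma hdist_box p q (s w h : R) : 0 < s ->
  s <= (val p).2 <= s * h -> s <= (val q).2 <= s * h ->
  `|(val p).1 - (val q).1| <= s * w ->
  hdist p q <= ln (2 + w ^+ 2 + h ^+ 2).
Proof.
rewrite hdistE; case: p q => -[x y] /= y0 [[x' y'] /= y'0] s0.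
move=> /andP [y1 y2] /andP [y1' y2'] xw.
have yy : 0 < 2 * y * y' by rewrite !mulr_gt0.
have sqr_le (a b : R) : `|a| <= b -> a ^+ 2 <= b ^+ 2.
  move=> ab; rewrite -(real_normK (num_real a)) lerXn2r ?nnegrE //.
  exact: le_trans ab.
have X := sqr_le _ _ xw.
have Y : (y - y') ^+ 2 <= (s * h) ^+ 2.
  by apply: sqr_le; rewrite ler_norml; apply/andP; split; lra.
have ss : s ^+ 2 <= y * y' by rewrite expr2 ler_pM // ltW.
have B : ((x - x') ^+ 2 + (y - y') ^+ 2) / (2 * y * y') <= (w ^+ 2 + h ^+ 2) / 2.
  rewrite ler_pdivrMr //.
  have : s ^+ 2 * (w ^+ 2 + h ^+ 2) <= y * y' * (w ^+ 2 + h ^+ 2).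
    by rewrite ler_wpM2r // addr_ge0 ?sqr_ge0.
  move: X Y; rewrite !exprMn; lra.
have B0 : 0 <= ((x - x') ^+ 2 + (y - y') ^+ 2) / (2 * y * y').
  by rewrite divr_ge0 ?addr_ge0 ?sqr_ge0 // ltW.
apply: le_trans (arccosh_le_ln _) _; first by lra.
have w2 := sqr_ge0 w; have h2 := sqr_ge0 h.
by rewrite ler_ln ?posrE; lra.
Qed.

Lemma hchi_le (a b : R) n : hcolorable a b n -> (hchi a b <= n%:R%:E)%E.
Proof.
move=> ab; rewrite /hchi; case: pselect => [ex|[]]; last by exists n; apply/asboolP.
case: ex_minnP => m _ mn; rewrite lee_fin ler_nat.
by apply: mn; apply/asboolP.
Qed.

Lemma hcolorable_card (T : finType) (a b : R) (f : hplane R -> T) :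
  (forall p q, a <= hdist p q <= b -> f p <> f q) -> hcolorable a b #|T|.
Proof.
by move=> fP; exists (enum_rank \o f) => p q /fP fpq /enum_rank_inj.
Qed.

Definition strip p : int := Num.floor (ln (val p).2).

Definition box (w : R) p : int :=
  Num.floor ((val p).1 / (w * expR (strip p)%:~R)).

Lemma strip_itv p :
  expR (strip p)%:~R <= (val p).2 <= expR (strip p)%:~R * expR 1.
Proof.
have y0 : 0 < (val p).2 by case: p.
have /andP [h1 h2] := floor_itv (ln (val p).2); rewrite -/(strip p) in h1 h2.
rewrite -expRD -[X in _ <= X <= _](lnK (x := (val p).2)) ?posrE //.
by rewrite !ler_expR h1 /= ltW // -intrD1.
Qed.

(** The last three hypotheses exclude, in order, a conflict within one box, between different
    strips, and between different boxes of one strip. *)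
Lemma box_coloring (a b w : R) (K m : nat) : 0 < w ->
  ln (2 + w ^+ 2 + expR 1 ^+ 2) < a -> b < K%:R ->
  expR 1 * expR (b / 2) <= m%:R * w ->
  hcolorable a b (K.+1 * m.+1)%N.
Proof.
move=> w0 wa bK bm.
rewrite -[K.+1]card_ord -[m.+1]card_ord -card_prod.
apply: (@hcolorable_card _ _ _ (fun p => (residue K (strip p), residue m (box w p)))).
move=> p q /andP [ad db] [eK em].
case: (residue_floor_eq eK) => [es|far]; last first.
  by have := dist_ln_le_hdist p q; lra.
rewrite -!/(strip _) in es.
pose s : R := expR (strip p)%:~R.
have s0 : 0 < s := expR_gt0 _.
have /andP [p1 p2] := strip_itv p; have /andP [q1 q2] := strip_itv q.
rewrite -es in q1 q2; rewrite -/s in p1 p2 q1 q2.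
have ws0 : 0 < w * s by rewrite mulr_gt0.
have wsE : `|(val p).1 / (w * s) - (val q).1 / (w * s)|
           = `|(val p).1 - (val q).1| / (w * s).
  by rewrite -mulrBl normrM normfV (gtr0_norm ws0).
move: (em); rewrite /box -es -/s => /residue_floor_eq [eb|far].
- have : hdist p q <= ln (2 + w ^+ 2 + expR 1 ^+ 2).
    apply: (@hdist_box _ _ s) => //; rewrite ?p1 ?q1 //.
    rewrite mulrC -[leRHS]mul1r -ler_pdivrMr // -wsE.
    have /andP [f1 f2] := floor_itv ((val p).1 / (w * s)).
    have /andP [g1 g2] := floor_itv ((val q).1 / (w * s)).
    move: f1 f2 g1 g2; rewrite eb !intrD => f1 f2 g1 g2.
    by rewrite ler_norml; apply/andP; split; lra.
  by lra.
- have : b < hdist p q.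
    (* The common height bound is the top of the strip, [s * expR 1], which accounts for the factor
       [expR 1] in [bm]. *)
    apply: (hdist_gt_horizontal p2 q2).
    move: far; rewrite wsE ltr_pdivlMr // => /ltW; apply: le_trans.
    by have := ler_wpM2r (ltW s0) bm; lra.
  by lra.
Qed.

End HyperbolicPlane.

Theorem mainTheorem8 (R : realType) (c : R) (hc : 1 < c) :
  exists2 d0 : R, 0 < d0 &
    forall d : R, d0 <= d ->
      (hchi d (c * d) <
        (2 * (2 * expR ((c * d - 1) / 2) + 1) * (c * d + 1))%:E)%E.
Proof.
(* The factor e cancels the one in [box_coloring], and the 4 reduces the requirement on [m] to E / 4
   <= m. *)
set w : R := 4 * expR 1.
have w0 : 0 < w by rewrite mulr_gt0 ?expR_gt0.
have l0 : 0 <= ln (2 + w ^+ 2 + expR 1 ^+ 2).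
  by apply: ln_ge0; have := sqr_ge0 w; have := sqr_ge0 (expR 1 : R); lra.
(* The added 1 puts d strictly above the box diameter and, by [l0], gives d >= 1, so c d > 1. *)
exists (ln (2 + w ^+ 2 + expR 1 ^+ 2) + 1); first by lra.
move=> d dd.
have cd1 : 1 < c * d by nra.
set E := expR (c * d / 2).
have E1 : 3 / 2 < E by have := expR_ge1Dx (c * d / 2); rewrite -/E; lra.
have EE : E / 2 <= expR ((c * d - 1) / 2).
  have -> : (c * d - 1) / 2 = c * d / 2 + - (1 / 2) by lra.
  rewrite expRD -/E ler_pM2l; last by lra.
  by have := expR_ge1Dx (- (1 / 2) : R); lra.
have cd0 : 0 <= c * d by lra.
have E40 : 0 <= E / 4 by lra.
have /andP [k1 k2] := truncn_itv cd0.
have /andP [m1 m2] := truncn_itv E40.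
set K := Num.truncn (c * d) in k1 k2; set m := Num.truncn (E / 4) in m1 m2.
(* One successor rounds the truncation up, the other is the extra residue in [box_coloring]. *)
apply: (@le_lt_trans _ _ (K.+2 * m.+2)%:R%:E).
  apply: hchi_le; apply: (@box_coloring _ _ _ w K.+1 m.+1) => //; first by lra.
  rewrite -/E /w mulrCA [leLHS]mulrC mulrA ler_pM2r ?expR_gt0 //; lra.
rewrite lte_fin natrM -(addn2 K) -(addn2 m) !natrD.
apply: (@le_lt_trans _ _ ((c * d + 2) * (E / 4 + 2))).
  by rewrite ler_pM ?lerD2r.
(* As c d > 1, c d + 2 < (3/2) (c d + 1); and (3/2) (E / 4 + 2) < 2 (E + 1), which [EE] compares
   with the target. *)
nra.
Qed.
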